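(* Let $\lambda,\mu,\theta,\gamma,c>0$ and $p\in[0,1]$, and let $(q^*,s^* )$ be the steady state (the point at which both right-hand sides vanish) of the system $$\frac{dq(t)}{dt}=\lambda-\mu\,(q(t)\wedge s(t))-\theta\,(q(t)-s(t))^+,\qquad \frac{ds(t)}{dt}=\gamma\,(c-s(t))-p\mu\,(q(t)\wedge s(t)).$$ If $\frac{\lambda}{\mu}+\frac{\lambda p}{\gamma}\le c$, then $$q^*=\frac{\lambda}{\mu},\qquad s^*=c-\frac{\lambda p}{\gamma}.$$ If $\frac{\lambda}{\mu}+\frac{\lambda p}{\gamma}>c$, then $$q^*=\frac{\lambda-\frac{\gamma\mu c}{\gamma+p\mu}}{\theta}+\frac{\gamma c}{\gamma+p\mu},\qquad s^*=\frac{\gamma c}{\gamma+p\mu}.$$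
   Context: $a\wedge b=\min\{a,b\}$ and $x^+=\max\{x,0\}$. *)

(* Defs.v *)
From HB Require Import structures.
From mathcomp Require Import all_boot all_order all_algebra.
From mathcomp Require Import reals.

Set Implicit Arguments.
Unset Strict Implicit.
Unset Printing Implicit Defensive.

Import Order.TTheory GRing.Theory Num.Theory.
Local Open Scope ring_scope.

Definition pos_part (R : realType) (x : R) : R := Num.max x 0.

(* The right-hand sides of
     dq/dt = lambda - mu (q /\ s) - theta (q - s)^+,
     ds/dt = gamma (c - s) - p mu (q /\ s). *)
Definition q_rhs (R : realType) (lambda mu theta q s : R) : R :=
  lambda - mu * Num.min q s - theta * pos_part (q - s).

Definition s_rhs (R : realType) (mu gamma c p q s : R) : R :=
  gamma * (c - s) - p * mu * Num.min q s.

Definition steady_state (R : realType) (lambda mu theta gamma c p : R)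
    (x : R * R) : Prop :=
  q_rhs lambda mu theta x.1 x.2 = 0 /\ s_rhs mu gamma c p x.1 x.2 = 0.

(* Main.v *)
Require Import Defs.
From HB Require Import structures.
From mathcomp Require Import all_boot all_order all_algebra.
From mathcomp Require Import reals.
From mathcomp Require Import ring lra.

(** The right-hand sides are linear on each of the half-planes [q <= s] and
    [s < q], where [min q s] is [q], respectively [s]. On each half-plane the
    two equations form a triangular linear system, hence have exactly one
    solution in the plane; what remains is to see whether this candidate lies
    in the half-plane it was computed for.

    The candidate for [q <= s] does when [lambda / mu <= c - lambda p / gamma],
    i.e. when the load [lambda / mu + lambda p / gamma] is at most [c]. The
    candidate for [s < q] has [theta (q - s) = lambda - mu s], so it does when
    [mu s < lambda], which turns out to be the complementary condition, load
    greater than [c] ([overloaded_candidateE]). So for all parameters exactly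
    one candidate lies in its own half-plane, and it is the unique steady state
    ([steady_state_iff]); existence, uniqueness and both formulas follow. *)

Set Implicit Arguments.
Unset Strict Implicit.
Unset Printing Implicit Defensive.

Import Order.TTheory GRing.Theory Num.Theory.
Local Open Scope ring_scope.

Section SteadyState.

Variables (R : realType) (lambda mu theta gamma c p : R).
Hypotheses (mu_gt0 : 0 < mu) (theta_gt0 : 0 < theta).
Hypotheses (gamma_gt0 : 0 < gamma) (p_ge0 : 0 <= p).

Let steady := steady_state lambda mu theta gamma c p.
Let load := lambda / mu + lambda * p / gamma.

Definition underloaded_state : R * R :=
  (lambda / mu, c - lambda * p / gamma).

Definition overloaded_state : R * R :=
  ((lambda - gamma * mu * c / (gamma + p * mu)) / theta
     + gamma * c / (gamma + p * mu),
   gamma * c / (gamma + p * mu)).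

Let gamma_pmu_gt0 : 0 < gamma + p * mu.
Proof. by rewrite ltr_wpDr// mulr_ge0// ltW. Qed.

Lemma steady_state_le (q s : R) : q <= s ->
  steady (q, s) <-> (q, s) = underloaded_state.
Proof.
move=> qs; rewrite /steady /steady_state /q_rhs /s_rhs /pos_part /=.
rewrite (min_idPl qs) max_r ?subr_le0// mulr0 subr0.
have mu0 := lt0r_neq0 mu_gt0; have gamma0 := lt0r_neq0 gamma_gt0.
split=> [[eq_q eq_s]|[-> ->]]; last by split; field; rewrite ?mu0 ?gamma0.
have lambdaE : lambda = mu * q by lra.
rewrite /underloaded_state lambdaE; congr (_, _); first by field.
apply: (mulfI gamma0).
have -> : gamma * (c - mu * q * p / gamma) = gamma * c - mu * q * p by field.
lra.
Qed.

Lemma steady_state_ge (q s : R) : s <= q ->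
  steady (q, s) <-> (q, s) = overloaded_state.
Proof.
move=> sq; rewrite /steady /steady_state /q_rhs /s_rhs /pos_part /=.
rewrite (min_idPr sq) max_l ?subr_ge0//.
have theta0 := lt0r_neq0 theta_gt0; have gpmu0 := lt0r_neq0 gamma_pmu_gt0.
split=> [[eq_q eq_s]|[-> ->]]; last by split; field; rewrite ?theta0 ?gpmu0.
have sE : s = gamma * c / (gamma + p * mu).
  by apply: (mulIf gpmu0); rewrite divfK//; lra.
have muE : gamma * mu * c / (gamma + p * mu) = mu * s by rewrite sE; field.
rewrite /overloaded_state -sE muE; congr (_, _).
by apply: (mulfI theta0); rewrite mulrDr mulrCA divff// mulr1; lra.
Qed.

Lemma underloaded_candidateE :
  (underloaded_state.1 <= underloaded_state.2) = (load <= c).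
Proof. by rewrite /= lerBrDr. Qed.

(** Both differences have the sign of [lambda (gamma + p mu) - gamma mu c]:
    the gap [q - s] after multiplication by [theta (gamma + p mu)], and
    [load - c] after multiplication by [mu gamma]. *)
Lemma overloaded_candidateE :
  (overloaded_state.2 < overloaded_state.1) = (c < load).
Proof.
rewrite -[LHS]subr_gt0 -[RHS]subr_gt0 /=.
have theta0 := lt0r_neq0 theta_gt0; have gpmu0 := lt0r_neq0 gamma_pmu_gt0.
have mu0 := lt0r_neq0 mu_gt0; have gamma0 := lt0r_neq0 gamma_gt0.
rewrite addrK -(pmulr_rgt0 _ (mulr_gt0 theta_gt0 gamma_pmu_gt0)).
rewrite -[RHS](pmulr_rgt0 _ (mulr_gt0 mu_gt0 gamma_gt0)).
by congr (0 < _); rewrite /load; field; rewrite ?theta0 ?gpmu0 ?mu0 ?gamma0.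
Qed.

Lemma steady_state_iff (x : R * R) :
  steady x <-> x = if load <= c then underloaded_state else overloaded_state.
Proof.
split=> [|->]; last first.
  case: ifPn => [|]; first by rewrite -underloaded_candidateE => /steady_state_le->.
  by rewrite -ltNge -overloaded_candidateE => /ltW/steady_state_ge->.
case: x => q s; case: (leP q s) => [qs|sq].
- move=> /(steady_state_le qs) x_eq.
  by move: qs; rewrite -[q <= s]/((q, s).1 <= (q, s).2) x_eq
    underloaded_candidateE => ->.
- move=> /(steady_state_ge (ltW sq)) x_eq.
  by move: sq; rewrite -[s < q]/((q, s).2 < (q, s).1) x_eq
    overloaded_candidateE ltNge => /negPf->.
Qed.

End SteadyState.

Theorem theorem3p2 (R : realType) (lambda mu theta gamma c p : R)
    (hlambda : 0 < lambda) (hmu : 0 < mu) (htheta : 0 < theta)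
    (hgamma : 0 < gamma) (hc : 0 < c) (hp : 0 <= p <= 1) :
  (exists! x : R * R, steady_state lambda mu theta gamma c p x) /\
  (forall qstar sstar : R,
    steady_state lambda mu theta gamma c p (qstar, sstar) ->
    (lambda / mu + lambda * p / gamma <= c ->
      qstar = lambda / mu /\ sstar = c - lambda * p / gamma) /\
    (lambda / mu + lambda * p / gamma > c ->
      qstar = (lambda - gamma * mu * c / (gamma + p * mu)) / theta
              + gamma * c / (gamma + p * mu) /\
      sstar = gamma * c / (gamma + p * mu))).
Proof.
have /andP[p_ge0 _] := hp.
have ssP := steady_state_iff lambda c hmu htheta hgamma p_ge0.
split; last first.
  move=> q s /ssP; case: leP => _ x_eq; split=> //= _;
    by case: x_eq => -> ->.
by eexists; split=> [|y /ssP->//]; apply/ssP.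
Qed.
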